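(* Let $n\ge 2s>0$ be integers with $(n,s)\ne(4,2)$, let $X$ be an $n$-element set, and let $\mathscr{A},\mathscr{B},\mathscr{C}\subset 2^X$ be nonempty antichains that are cross $s$-union, that is, $|A\cup B\cup C|\le s$ for all $A\in\mathscr{A}$, $B\in\mathscr{B}$, $C\in\mathscr{C}$. Then $$|\mathscr{A}|+|\mathscr{B}|+|\mathscr{C}|\le 2+\binom{n}{s}.$$ If $(n,s)\ne(6,3)$, equality holds if and only if, up to reordering the three families, $\{\mathscr{A},\mathscr{B},\mathscr{C}\}=\left\{\binom{X}{s},\{\emptyset\},\{\emptyset\}\right\}$. If $(n,s)=(6,3)$, equality holds if and only if, up to reordering, $\{\mathscr{A},\mathscr{B},\mathscr{C}\}$ is either $\left\{\binom{X}{3},\{\emptyset\},\{\emptyset\}\right\}$ or $\left\{\binom{X}{2},\binom{X}{1},\{\emptyset\}\right\}$ (as multisets).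
   Context: $2^X$ is the power set of $X$ and $\binom{X}{i}$ is the family of all $i$-element subsets of $X$. A family $\mathscr{F}\subset 2^X$ is an antichain if $F\subset F'$ never holds for distinct $F,F'\in\mathscr{F}$. *)

(* Defs.v *)
From mathcomp Require Import all_boot.

Set Implicit Arguments.
Unset Strict Implicit.
Unset Printing Implicit Defensive.

Definition antichain (X : finType) (F : {set {set X}}) : Prop :=
  forall A B : {set X}, A \in F -> B \in F -> A != B -> ~~ (A \subset B).

Definition cross_union (X : finType) (s : nat) (F G H : {set {set X}}) : Prop :=
  forall A B C : {set X},
    A \in F -> B \in G -> C \in H -> #|A :|: B :|: C| <= s.

Definition ksubsets (X : finType) (k : nat) : {set {set X}} :=
  [set A : {set X} | #|A| == k].

(* Main.v *)
Require Import Defs.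
From mathcomp Require Import all_boot.
From mathcomp Require Import all_fingroup zify.

Set Implicit Arguments.
Unset Strict Implicit.
Unset Printing Implicit Defensive.

(** A random permutation of [X] carries three fixed chains of subsets to three
    random chains, each member of which is uniformly distributed among the sets
    of its size.  An antichain meets a chain at most once; if a family scores
    [C(n, i)] whenever its chain hits it at size [i], its expected score is
    exactly its cardinality ([sum_weight]).  So it is enough to bound the total
    score of three families for every single permutation.

    The chains are made of segments of a linear order of [X]: initial segments
    for [F], final segments for [G], and segments growing rightwards from
    position [s - 1] for [H].  Suppose that no member of [F] has [s] elements.
    Then the segment of [F] ends before position [s - 1], where that of [H]
    starts, and if the segments of [G] and [H] overlapped they would cover all
    the [n - s + 1 > s] positions from [s - 1] on.  Hence the three sets are
    disjoint, and their sizes satisfy [i + j + k <= s] ([cover_segs]).  The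
    score is then at most [C(n, i) + C(n, j) + C(n, k) <= 2 + C(n, s)], which
    follows by merging two sizes twice with
    [C(n, i) + C(n, j) <= 1 + C(n, i + j)] ([bin_add], [bin_add3]).

    If each family has a member of size [s], these members all coincide with
    their union, each family is that singleton, and the total is only 3.
    Otherwise the families can be reordered so that [F] is as above.

    In case of equality every permutation attains the maximal score, so that for
    every permutation the three chains hit at sizes [(s, 0, 0)], or possibly
    [(2, 1, 0)] when [(n, s) = (6, 3)], up to order.  A family hit at size 0 is
    [{set0}], and a family hit at size [s] by all permutations contains all
    [s]-sets; [extremal_level] and [extremal_6_3] turn this into the description
    of the extremal triples. *)

(** * Sums of binomial coefficients *)

Lemma bin_ltS n m : m.*2.+1 < n -> 'C(n, m) < 'C(n, m.+1).
Proof.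
move=> h; have := mul_bin_left n m; have : 0 < 'C(n, m) by rewrite bin_gt0; lia.
by nia.
Qed.

Lemma bin_lt n a b : a < b -> b.*2 <= n -> 'C(n, a) < 'C(n, b).
Proof.
elim: b => // b IH; rewrite ltnS leq_eqVlt => /predU1P[-> | lt_ab] h.
  by apply: bin_ltS; lia.
by apply: ltn_trans (IH lt_ab _) (bin_ltS _); lia.
Qed.

Lemma bin_le n a b : a <= b -> b.*2 <= n -> 'C(n, a) <= 'C(n, b).
Proof. by rewrite leq_eqVlt => /predU1P[-> // | lt_ab] /(bin_lt lt_ab)/ltnW. Qed.

(** The increment [C(n, j + 1) - C(n, j)] is [C(n, j) (n - 2 j - 1) / (j + 1)].
    As [2 j + 2 <= n] this is at least [C(n, j) / (j + 1)], which exceeds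
    [n - 1] for [j >= 3] because then [C(n, j) >= C(n, 3)]; the two excluded
    pairs are those where the increment is too small for [j <= 2]. *)
Lemma bin_add_lt1 n j : 0 < j -> j.+1.*2 <= n -> (n, j) <> (4, 1) ->
  (n, j) <> (6, 2) -> n + 'C(n, j) < 1 + 'C(n, j.+1).
Proof.
move=> j0 hn n4 n6.
have step := mul_bin_left n j.
have [j1 | j2 | j3] : [\/ j = 1, j = 2 | 3 <= j].
  by case: j j0 {hn n4 n6 step} => [|[|[|j]]]; constructor.
- subst j; have {}n4 : n <> 4 by move=> e; apply: n4; rewrite e.
  by rewrite bin1 in step *; nia.
- subst j; have {}n6 : n <> 6 by move=> e; apply: n6; rewrite e.
  have s1 := mul_bin_left n 1; rewrite bin1 in s1.
  have : 6 < n by lia.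
  nia.
- have ge3 : 'C(n, 3) <= 'C(n, j) by apply: bin_le; lia.
  have s1 := mul_bin_left n 1; rewrite bin1 in s1.
  have s2 := mul_bin_left n 2.
  have e3 : 6 * 'C(n, 3) = n * (n - 1) * (n - 2) by nia.
  have : (j.+1) * (n - 1) < 'C(n, j).
    have : n * (n - 1) < 2 * 'C(n, j) by nia.
    by have := leq_mul hn (leqnn (n - 1)); lia.
  have := leq_mul (_ : j.+2 <= n - j) (leqnn 'C(n, j)).
  rewrite -step => /(_ ltac:(lia)).
  rewrite mulSn => le lt; have : j.+1 * ((n - 1) + 'C(n, j)) < j.+1 * 'C(n, j.+1).
    by rewrite mulnDr; lia.
  by rewrite ltn_pmul2l //; lia.
Qed.

(** Here the single increment from [j] to [j + 1] already pays for [C(n, i)]: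
    it is at least [C(n, j) (2 i - 1) / (j + 1)].  For [i = j] the factor is at
    least 1, and for [i < j] the ratio
    [C(n, j) / C(n, i) >= (n - i) / (i + 1)] makes up for it. *)
Lemma bin_add_lt2 n i j : 1 < i -> i <= j -> (i + j).*2 <= n ->
  'C(n, i) + 'C(n, j) < 1 + 'C(n, i + j).
Proof.
move=> i1 ij hn.
have step := mul_bin_left n j.
have le_t : 'C(n, j.+1) <= 'C(n, i + j) by apply: bin_le; lia.
suff : j.+1 * 'C(n, i) <= (n - j - j.+1) * 'C(n, j) by nia.
move: ij; rewrite leq_eqVlt => /predU1P[eq_ij | lt_ij].
  by subst j; apply: leq_mul => //; lia.
have ge : 'C(n, i.+1) <= 'C(n, j) by apply: bin_le => //; lia.
have si := mul_bin_left n i.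
suff : i.+1 * (j.+1 * 'C(n, i)) <= i.+1 * ((n - j - j.+1) * 'C(n, i.+1)).
  by rewrite leq_pmul2l // => /leq_trans; apply; rewrite leq_mul2l ge orbT.
rewrite (mulnCA i.+1 (n - _ - _)) si !mulnA leq_mul2r; apply/orP; right.
by apply: leq_mul; lia.
Qed.

Lemma bin_add n i j : (i + j).*2 <= n -> (n, i + j) <> (4, 2) ->
  'C(n, i) + 'C(n, j) <= 1 + 'C(n, i + j) /\
  ('C(n, i) + 'C(n, j) = 1 + 'C(n, i + j) ->
     [\/ i = 0, j = 0 | n = 6 /\ i + j = 3]).
Proof.
wlog ij : i j / i <= j => [wl | hn n4].
  case: (leqP i j) => [/wl // | /ltnW/wl {}wl]; rewrite addnC ['C(_, _) + _]addnC.
  move=> h1 h2; have [le eq] := wl h1 h2; split=> // /eq[].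
  - by constructor 2.
  - by constructor 1.
  - by constructor 3.
case: i ij hn n4 => [|[|i]] ij hn n4.
- by rewrite bin0 add0n; split=> // _; constructor 1.
- case: (eqVneq n 6) => [n6 | n6]; last first.
    suff : n + 'C(n, j) < 1 + 'C(n, j.+1) by rewrite bin1 add1n; lia.
    apply: bin_add_lt1 => //; try lia.
      by case=> en ej; apply: n4; rewrite en ej.
    by case=> en ej; rewrite en in n6.
  have [j1 | j2] : j = 1 \/ j = 2 by lia.
    by subst; split; vm_compute.
  by subst; split=> [|_]; [vm_compute | constructor 3].
- by have := bin_add_lt2 (isT : 1 < i.+2) ij hn; lia.
Qed.

(** The arithmetic shape of the equality cases: given the sum [s], the second
    clause says that the sizes are [(s, 0, 0)] or, for [n = 6] and [s = 3],
    possibly [(2, 1, 0)], in some order. *)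
Definition optimal n s i j k :=
  i + j + k = s /\
  (i = s \/ j = s \/ k = s \/ n = 6 /\ s = 3 /\ (i = 0 \/ j = 0 \/ k = 0)).

Lemma bin_add3 n s i j k : s.*2 <= n -> (n, s) <> (4, 2) -> i + j + k <= s ->
  'C(n, i) + 'C(n, j) + 'C(n, k) <= 2 + 'C(n, s) /\
  ('C(n, i) + 'C(n, j) + 'C(n, k) = 2 + 'C(n, s) -> optimal n s i j k).
Proof.
move=> hn n4 le_s.
have n4' t : t <= s -> (n, t) <> (4, 2).
  by move=> ts [en et]; apply: n4; congr pair; lia.
have [||le1 eq1] := @bin_add n i j; [lia | apply: n4'; lia |].
have [||le2 eq2] := @bin_add n (i + j) k; [lia | apply: n4'; lia |].
have le3 := bin_le le_s hn.
split; first lia.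
move=> e; have ijk : i + j + k = s.
  move: le_s; rewrite leq_eqVlt => /predU1P[// | lt_s]; have := bin_lt lt_s hn; lia.
split=> //.
have {}eq1 := eq1 ltac:(lia); have {}eq2 := eq2 ltac:(lia).
by case: eq1 => [i0 | j0 | [n6 ij3]]; case: eq2 => [ij0 | k0 | [n6' ijk3]]; lia.
Qed.

Lemma optimalC n s i j k : optimal n s i j k -> optimal n s j i k.
Proof. by rewrite /optimal; lia. Qed.

Lemma optimalR n s i j k : optimal n s i j k -> optimal n s i k j.
Proof. by rewrite /optimal; lia. Qed.

(** * Random chains *)

Section RandomChains.
Variable X : finType.
Implicit Types (A B : {set X}) (K : {set {set X}}) (sigma : {perm X}).
Implicit Types (T : nat -> {set X}).

Lemma perm_imset_eq_card A B : #|A| = #|B| -> exists sigma, sigma @: A = B.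
Proof.
move=> eAB.
pose l (D : {set X}) := enum D ++ enum (~: D).
have lU D : uniq (l D).
  rewrite cat_uniq !enum_uniq andbT; apply/hasPn => x /=.
  by rewrite !mem_enum inE.
have lM D x : x \in l D by rewrite mem_cat !mem_enum inE orbN.
have lS D : size (l D) = #|X| by rewrite size_cat -!cardE cardsC.
pose f x := nth x (l B) (index x (l A)).
have fI : injective f.
  move=> x y; rewrite /f (set_nth_default x y) ?lS -?(lS A) ?index_mem //.
  move/eqP; rewrite nth_uniq ?lS -?(lS A) ?index_mem // => /eqP.
  exact: index_inj.
exists (perm fI); apply/eqP.
rewrite eqEcard card_imset ?eAB ?leqnn ?andbT; last exact: perm_inj.
apply/subsetP=> _ /imsetP[x xA ->]; rewrite permE /f /l index_cat mem_enum xA nth_cat.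
have lt : index x (enum A) < size (enum B).
  by rewrite -cardE -eAB cardE index_mem mem_enum.
by rewrite lt -mem_enum mem_nth.
Qed.

(** Composing with a permutation that carries [A] to [D] shows that all sets of
    size [#|A|] are images of [A] equally often. *)
Lemma card_perm_fiber A B : #|A| = #|B| ->
  #|[set sigma : {perm X} | sigma @: A == B]| * 'C(#|X|, #|A|) = #|{perm X}|.
Proof.
move=> eAB.
have fib (D : {set X}) : #|A| = #|D| ->
    #|[set sigma : {perm X} | sigma @: A == D]|
      = #|[set sigma : {perm X} | sigma @: A == A]|.
  move=> /perm_imset_eq_card[tau tauA].
  rewrite -[RHS](card_imset _ (mulIg tau)); apply: eq_card => sigma.
  apply/idP/imsetP => [|[rho + ->]]; rewrite !inE => /eqP e.
    exists (sigma * tau^-1)%g; last by rewrite mulgKV.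
    rewrite inE (eq_imset _ (permM _ _)) imset_comp e -tauA -imset_comp.
    by rewrite (eq_imset (g := id)) ?imset_id // => x /=; rewrite permK.
  by rewrite (eq_imset _ (permM _ _)) imset_comp e tauA.
rewrite fib // -card_draws -[RHS]sum1_card.
rewrite [RHS](partition_big (fun sigma : {perm X} => sigma @: A)
  (mem [set D : {set X} | #|D| == #|A|])) /=; last first.
  by move=> sigma _; rewrite inE card_imset //; apply: perm_inj.
rewrite [RHS](eq_bigr
  (fun=> #|[set sigma : {perm X} | sigma @: A == A]|)) => [|D].
  by rewrite sum_nat_const mulnC.
by rewrite inE => /eqP eD; rewrite sum1dep_card fib.
Qed.

Definition chain s T :=
  (forall i, i <= s -> #|T i| = i) /\ (forall i j, i <= j <= s -> T i \subset T j).

Definition weight s T K sigma :=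
  \sum_(i < s.+1 | sigma @: T i \in K) 'C(#|X|, i).

(** A set [A] in [K] is the image of [T #|A|] with probability
    [1 / C(n, #|A|)], and then contributes [C(n, #|A|)] to the weight. *)
Lemma sum_weight s T K :
    chain s T -> (forall A, A \in K -> #|A| <= s) ->
  \sum_(sigma : {perm X}) weight s T K sigma = #|{perm X}| * #|K|.
Proof.
move=> [cT _] cK; rewrite /weight (exchange_big_dep predT) //=.
transitivity (\sum_(i < s.+1) \sum_(A in K | #|A| == i) #|{perm X}|).
  apply: eq_bigr => i _; have ci : #|T i| = i by rewrite cT // -ltnS.
  rewrite (partition_big (fun sigma : {perm X} => sigma @: T i)
    (fun A => (A \in K) && (#|A| == i))) /=; last first.
    by move=> sigma ->; rewrite card_imset ?ci ?eqxx //; apply: perm_inj.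
  apply: eq_bigr => A /andP[AK /eqP cA].
  rewrite -(card_perm_fiber (A := T i) (B := A)) ?ci //.
  rewrite -sum_nat_const; apply: eq_bigl => sigma.
  by rewrite inE andb_idl // => /eqP ->.
rewrite -(exchange_big_dep predT) //=.
rewrite (eq_bigr (fun=> #|{perm X}|)) ?sum_nat_const 1?mulnC // => A AK.
by rewrite (big_pred1 (Ordinal (cK A AK : #|A| < s.+1))) // => i; rewrite eq_sym.
Qed.

(** When the chain misses [K] the index is [i = 0]: the empty set lies in some
    member of [K], which is all that the cross-union condition needs, and the
    weight 0 is smaller than [C(n, 0) = 1].  This makes misses behave like hits
    in the estimates, and never in the equality case. *)
Lemma weightP s T K sigma :
    chain s T -> antichain K -> K != set0 ->
  exists i, [/\ i <= s, weight s T K sigma <= 'C(#|X|, i),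
     exists2 A, A \in K & sigma @: T i \subset A
   & weight s T K sigma = 'C(#|X|, i) -> sigma @: T i \in K].
Proof.
move=> [cT mT] aK /set0Pn[A0 A0K].
have [i0 hi0 | none] := pickP (fun i : 'I_s.+1 => sigma @: T i \in K); last first.
  exists 0; rewrite /weight big_pred0 // bin0; split=> //.
  by exists A0 => //; rewrite (cards0_eq (cT 0 (leq0n s))) imset0 sub0set.
have is_i0 : (fun i : 'I_s.+1 => sigma @: T i \in K) =1 pred1 i0.
  move=> i; apply/idP/eqP => [hi | -> //]; apply: contraTeq hi => ne.
  apply/negP=> hi.
  have ne' (a b : 'I_s.+1) :
      sigma @: T a \in K -> sigma @: T b \in K -> a < b -> False.
    move=> ha hb lt_ab; have le_b : b <= s by rewrite -ltnS.
    have le_a := leq_trans (ltnW lt_ab) le_b.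
    have ne_im : sigma @: T a != sigma @: T b.
      apply: contraTneq lt_ab => /(congr1 (fun D : {set X} => #|D|)).
      rewrite !card_imset ?cT //; try exact: perm_inj.
      by move=> ->; rewrite ltnn.
    by have /negP[] := aK _ _ ha hb ne_im; rewrite imsetS // mT // (ltnW lt_ab).
  by move: ne; rewrite neq_ltn => /orP[]; apply: ne'.
exists i0; rewrite /weight (eq_bigl _ _ is_i0) big_pred1_eq -ltnS.
by split=> //; exists (sigma @: T i0).
Qed.

(** * Segments *)

Definition seg a b := [set x : X | a <= enum_rank x < b].

Lemma card_seg a b : b <= #|X| -> #|seg a b| = b - a.
Proof.
move=> bn; rewrite -sum1dep_card (reindex_onto enum_val enum_rank) /=; last first.
  by move=> x _; rewrite enum_rankK.
rewrite (eq_bigl (fun i : 'I_#|X| => (a <= i) && (i < b))); last first.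
  by move=> i; rewrite enum_valK eqxx andbT.
rewrite -(big_mkord (fun i => (a <= i) && (i < b)) (fun=> 1)).
rewrite -big_nat_widen // -(big_nat_widenl _ 0 _ xpredT) //.
by rewrite sum_nat_const_nat muln1.
Qed.

Lemma seg_sub a b a' b' : a' <= a -> b <= b' -> seg a b \subset seg a' b'.
Proof. by move=> ha hb; apply/subsetP=> x; rewrite !inE; lia. Qed.

(** If the final segment meets the middle one, together they fill the [n - s + 1]
    positions from [s - 1] on, too many for a union of size at most [s];
    otherwise the three segments are disjoint. *)
Lemma cover_segs s i j k :
    0 < s -> s.*2 <= #|X| -> i < s -> j <= s -> k <= s ->
    #|seg 0 i :|: seg (#|X| - j) #|X| :|: seg s.-1 (s.-1 + k)| <= s ->
  i + j + k <= s.
Proof.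
move=> s0 hn hi hj hk; set n := #|X| in hn *.
have [meet | apart] := ltnP (n - j) (s.-1 + k).
  move/(leq_trans (subset_leq_card _)) => /(_ (seg s.-1 n)).
  rewrite card_seg //; suff sub : seg s.-1 n \subset
    seg 0 i :|: seg (n - j) n :|: seg s.-1 (s.-1 + k) by move/(_ sub); lia.
  by apply/subsetP=> x; rewrite !inE; lia.
have card_disjU A B : A :&: B = set0 -> #|A :|: B| = #|A| + #|B|.
  by move=> AB; rewrite cardsU AB cards0 subn0.
rewrite setUAC !card_disjU; first by rewrite !card_seg -/n; lia.
all: by apply/setP=> x; rewrite !inE; lia.
Qed.

Lemma chain_init s : s.*2 <= #|X| -> chain s (fun i => seg 0 i).
Proof.
by move=> hn; split=> [i hi | i j hij]; [rewrite card_seg | apply: seg_sub]; lia.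
Qed.

Lemma chain_final s : s.*2 <= #|X| -> chain s (fun j => seg (#|X| - j) #|X|).
Proof.
by move=> hn; split=> [i hi | i j hij]; [rewrite card_seg | apply: seg_sub]; lia.
Qed.

Lemma chain_middle s : s.*2 <= #|X| -> chain s (fun k => seg s.-1 (s.-1 + k)).
Proof.
by move=> hn; split=> [i hi | i j hij]; [rewrite card_seg | apply: seg_sub]; lia.
Qed.

End RandomChains.

(** * Extremal triples *)

Lemma perm_eq3C (T : eqType) (a b c d e f : T) :
  perm_eq [:: a; b; c] [:: d; e; f] -> perm_eq [:: b; a; c] [:: d; e; f].
Proof. by apply: perm_trans; apply/seq.permP=> p /=; lia. Qed.

Lemma perm_eq3R (T : eqType) (a b c d e f : T) :
  perm_eq [:: a; b; c] [:: d; e; f] -> perm_eq [:: a; c; b] [:: d; e; f].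
Proof. by apply: perm_trans; apply/seq.permP=> p /=; lia. Qed.

Lemma card_ksubsets (X : finType) k : #|ksubsets X k| = 'C(#|X|, k).
Proof. exact: card_draws. Qed.

Section ExtremalTriples.
Variable X : finType.
Implicit Types (A B : {set X}) (K F G H : {set {set X}}) (sigma : {perm X}).
Implicit Types (T : nat -> {set X}).

Lemma antichain_set0 K : antichain K -> set0 \in K -> K = [set set0].
Proof.
move=> aK K0; apply/setP=> A; rewrite inE; apply/idP/eqP => [AK | -> //].
by apply: contraTeq (sub0set A) => ne; apply: aK; rewrite // eq_sym.
Qed.

Lemma antichain_not_set0 K A :
  antichain K -> A \in K -> A != set0 -> set0 \notin K.
Proof.
by move=> aK AK; apply: contraNN => /(antichain_set0 aK) KE; rewrite KE inE in AK.
Qed.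

Definition all_optimal s T1 T2 T3 F G H :=
  forall sigma, exists i j k, [/\ optimal #|X| s i j k,
    sigma @: T1 i \in F, sigma @: T2 j \in G & sigma @: T3 k \in H].

Definition extremal s F G H :=
  perm_eq [:: F; G; H] [:: ksubsets X s; [set set0]; [set set0]] \/
  [/\ #|X| = 6, s = 3 &
   perm_eq [:: F; G; H] [:: ksubsets X 2; ksubsets X 1; [set set0]]].

Lemma full_level s T K :
  chain s T -> (forall sigma, sigma @: T s \in K) -> ksubsets X s \subset K.
Proof.
move=> [cT _] hT; apply/subsetP=> A; rewrite inE => /eqP cA.
by have [|sigma <-] := @perm_imset_eq_card _ (T s) A; rewrite ?cT.
Qed.

(** With [G] and [H] reduced to [{set0}] their chains can only hit at size 0, so
    [F] is hit at size [s] by every permutation. *)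
Lemma extremal_level s T1 T2 T3 F G H : 0 < s ->
    chain s T1 -> chain s T2 -> chain s T3 ->
    antichain G -> antichain H -> set0 \in G -> set0 \in H ->
    #|F| + #|G| + #|H| = 2 + 'C(#|X|, s) -> all_optimal s T1 T2 T3 F G H ->
  extremal s F G H.
Proof.
move=> s0 ch1 ch2 ch3 aG aH G0 H0 card opt; left.
have GE := antichain_set0 aG G0; have HE := antichain_set0 aH H0.
suff <- : ksubsets X s = F by rewrite GE HE.
apply/eqP; rewrite eqEcard (full_level ch1) /=.
  rewrite card_ksubsets; move: card; rewrite GE HE !cards1 -addnA addnC.
  by move=> /addnI ->.
move=> sigma; have [i [j [k [[ijk _] hF hG hH]]]] := opt sigma.
have zero T (m : nat) :
    chain s T -> m <= s -> sigma @: T m \in [set set0] -> m = 0.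
  move=> [cT _] ms; rewrite inE -cards_eq0 card_imset ?cT //; last exact: perm_inj.
  by move/eqP.
rewrite GE in hG; rewrite HE in hH.
have j0 : j = 0 by apply: zero ch2 _ hG; lia.
have k0 : k = 0 by apply: zero ch3 _ hH; lia.
by have <- : i = s by lia.
Qed.

(** Here [H = {set0}], and each permutation hits [F] and [G] at sizes [(2, 1)] or
    [(1, 2)].  As [G] contains one singleton [{x0}], it contains no pair
    [{x0, y}]; a permutation carrying [T2 2] to [{x0, y}] must then hit [G] at
    size 1, and so must its composite with the transposition of [x0] and [y].
    So [G] contains every singleton, hence no pair, and [F] is always hit at
    size 2.  The cardinality leaves room for nothing else. *)
Lemma extremal_6_3 s T1 T2 T3 F G H sigma0 :
    #|X| = 6 -> s = 3 ->
    chain s T1 -> chain s T2 -> chain s T3 ->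
    antichain F -> antichain G -> antichain H ->
    sigma0 @: T1 2 \in F -> sigma0 @: T2 1 \in G -> set0 \in H ->
    #|F| + #|G| + #|H| = 2 + 'C(#|X|, s) -> all_optimal s T1 T2 T3 F G H ->
  extremal s F G H.
Proof.
move=> n6 s3 ch1 ch2 ch3 aF aG aH F2 G1 H0 card opt; right; split=> //.
have HE := antichain_set0 aH H0.
have cardT T sigma m : chain s T -> m <= s -> #|sigma @: T m| = m.
  by move=> [cT _] ms; rewrite card_imset ?cT //; apply: perm_inj.
have F0 : set0 \notin F.
  by apply: antichain_not_set0 aF F2 _; rewrite -cards_eq0 cardT // s3.
have G0 : set0 \notin G.
  by apply: antichain_not_set0 aG G1 _; rewrite -cards_eq0 cardT // s3.
have hit sigma :
    sigma @: T2 1 \in G /\ sigma @: T1 2 \in F \/ sigma @: T2 2 \in G.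
  have [i [j [k [[ijk _] hF hG hH]]]] := opt sigma.
  have k0 : k = 0.
    by move: hH; rewrite HE inE -cards_eq0 cardT // => [/eqP | ]; lia.
  have i0 : i <> 0.
    move=> i0; case/negP: F0; rewrite -(cards0_eq (cardT _ sigma 0 ch1 isT)).
    by rewrite -i0.
  have j0 : j <> 0.
    move=> j0; case/negP: G0; rewrite -(cards0_eq (cardT _ sigma 0 ch2 isT)).
    by rewrite -j0.
  have [[ei ej] | ej] : (i = 2 /\ j = 1) \/ j = 2 by lia.
    by left; rewrite -ei -ej.
  by right; rewrite -ej.
have [x0 x0P] : exists x0, sigma0 @: T2 1 = [set x0].
  by apply/cards1P; rewrite cardT // s3.
rewrite x0P in G1.
have no2 x y : x != y -> [set x] \in G -> [set x; y] \notin G.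
  move=> xy xG; apply/negP=> xyG.
  have ne : [set x] != [set x; y].
    by apply: contra_neq xy => /setP/(_ y); rewrite !inE eqxx orbT => /eqP.
  by have := aG _ _ xG xyG ne; rewrite sub1set !inE eqxx.
have singles y : [set y] \in G.
  have [<- // | ne] := eqVneq x0 y.
  have [|tau tauP] := @perm_imset_eq_card _ (T2 2) [set x0; y].
    by rewrite cards2 ne ch2.1 // s3.
  have hit1 (rho : {perm X}) : rho @: T2 2 = [set x0; y] -> rho @: T2 1 \in G.
    move=> rhoP; case: (hit rho) => [[] // |].
    by rewrite rhoP (negPf (no2 _ _ ne G1)).
  have swap : (tau * tperm x0 y)%g @: T2 2 = [set x0; y].
    rewrite (eq_imset _ (permM _ _)) imset_comp tauP imsetU1 imset_set1.
    by rewrite tpermL tpermR setUC.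
  have [x xP] : exists x, tau @: T2 1 = [set x].
    by apply/cards1P; rewrite cardT // s3.
  have : x \in [set x0; y].
    by rewrite -tauP -sub1set -xP imsetS // ch2.2 // s3.
  rewrite !inE => /orP[]/eqP xE; last by rewrite -xE -xP hit1.
  have := hit1 _ swap; rewrite (eq_imset _ (permM _ _)) imset_comp xP.
  by rewrite imset_set1 xE tpermL.
have hit2 sigma : sigma @: T1 2 \in F.
  case: (hit sigma) => [[] // |].
  have /cards2P[x [y [xy ->]]] : #|sigma @: T2 2| == 2 by rewrite cardT // s3.
  by rewrite (negPf (no2 _ _ xy (singles x))).
have sub2 : ksubsets X 2 \subset F.
  apply: full_level hit2; split=> [m hm | m p hmp].
    by apply: ch1.1; lia.
  by apply: ch1.2; lia.
have sub1 : ksubsets X 1 \subset G.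
  by apply/subsetP=> A; rewrite inE => /cards1P[x ->].
have := subset_leq_card sub1; have := subset_leq_card sub2.
move: card; rewrite HE cards1 !card_ksubsets n6 s3.
rewrite (_ : 'C(6, 3) = 20) // (_ : 'C(6, 2) = 15) // (_ : 'C(6, 1) = 6) //.
move=> card geF geG.
have -> : F = ksubsets X 2.
  apply/esym/eqP; rewrite eqEcard sub2 card_ksubsets n6.
  by rewrite (_ : 'C(6, 2) = 15) //; lia.
suff -> : G = ksubsets X 1 by [].
apply/esym/eqP; rewrite eqEcard sub1 card_ksubsets n6.
by rewrite (_ : 'C(6, 1) = 6) //; lia.
Qed.

Lemma extremalC s F G H : extremal s F G H -> extremal s G F H.
Proof. by case=> [|[]] *; [left | right; split=> //]; apply: perm_eq3C. Qed.

Lemma extremalR s F G H : extremal s F G H -> extremal s F H G.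
Proof. by case=> [|[]] *; [left | right; split=> //]; apply: perm_eq3R. Qed.

(** Bundled so that families, chains and hit sizes can be permuted together. *)
Definition optimal_system s T1 T2 T3 F G H :=
  [/\ [/\ chain s T1, chain s T2 & chain s T3],
     [/\ antichain F, antichain G & antichain H],
     #|F| + #|G| + #|H| = 2 + 'C(#|X|, s)
   & all_optimal s T1 T2 T3 F G H].

Lemma optimal_systemC s T1 T2 T3 F G H :
  optimal_system s T1 T2 T3 F G H -> optimal_system s T2 T1 T3 G F H.
Proof.
move=> [[? ? ?] [? ? ?] card opt]; split=> //; first by rewrite (addnC #|G|).
move=> sigma; have [i [j [k [/optimalC o hF hG hH]]]] := opt sigma.
by exists j, i, k.
Qed.

Lemma optimal_systemR s T1 T2 T3 F G H :
  optimal_system s T1 T2 T3 F G H -> optimal_system s T1 T3 T2 F H G.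
Proof.
move=> [[? ? ?] [? ? ?] card opt]; split=> //; first by rewrite addnAC.
move=> sigma; have [i [j [k [/optimalR o hF hG hH]]]] := opt sigma.
by exists i, k, j.
Qed.

(** The sizes hit by the identity permutation tell which case occurs; reordering
    makes them decreasing. *)
Lemma optimal_system_extremal s T1 T2 T3 F G H : 0 < s ->
  optimal_system s T1 T2 T3 F G H -> extremal s F G H.
Proof.
move=> s0 sys.
have [i [j [k [o hF hG hH]]]] : exists i j k, [/\ optimal #|X| s i j k,
  (1%g : {perm X}) @: T1 i \in F, (1%g : {perm X}) @: T2 j \in G
  & (1%g : {perm X}) @: T3 k \in H] by case: sys => _ _ _ /(_ 1%g).
wlog le_kj : T1 T2 T3 F G H i j k sys o hF hG hH / k <= j.
  move=> wl; have [le_kj | /ltnW le_jk] := leqP k j.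
    exact: (wl T1 T2 T3 F G H i j k).
  exact/extremalR/(wl _ _ _ _ _ _ _ _ _
    (optimal_systemR sys) (optimalR o) hF hH hG).
wlog le_ji : T1 T2 T3 F G H i j k sys o hF hG hH le_kj / j <= i.
  move=> wl; have [le_ji | /ltnW le_ij] := leqP j i.
    exact: (wl T1 T2 T3 F G H i j k).
  have [le_ki | /ltnW le_ik] := leqP k i.
    exact/extremalC/(wl _ _ _ _ _ _ _ _ _
      (optimal_systemC sys) (optimalC o) hG hF hH).
  exact/extremalC/extremalR/(wl _ _ _ _ _ _ _ _ _
    (optimal_systemR (optimal_systemC sys)) (optimalR (optimalC o)) hG hH hF).
have [[ch1 ch2 ch3] [aF aG aH] card opt] := sys.
have set0P T K : chain s T -> (1%g : {perm X}) @: T 0 \in K -> set0 \in K.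
  by move=> [cT _]; rewrite (cards0_eq (cT 0 isT)) imset0.
have k0 : k = 0 by move: o; rewrite /optimal; lia.
rewrite k0 in hH; have H0 := set0P _ _ ch3 hH.
have [j0 | j0] := eqVneq j 0.
  rewrite j0 in hG; exact: extremal_level (set0P _ _ ch2 hG) H0 card opt.
have [n6 [s3 [i2 j1]]] : #|X| = 6 /\ s = 3 /\ i = 2 /\ j = 1.
  by move: o; rewrite /optimal; lia.
by rewrite i2 in hF; rewrite j1 in hG; apply: extremal_6_3 hF hG H0 card opt.
Qed.

(** * The bound *)

(** The three chains of segments turn the cross-union condition into
    [i + j + k <= s], so each permutation has total weight at most
    [2 + C(n, s)]; averaging over all permutations gives the bound, and equality
    forces every permutation to be optimal. *)
Lemma bound_extremal_lt s F G H :
    0 < s -> s.*2 <= #|X| -> (#|X|, s) <> (4, 2) ->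
    F != set0 -> G != set0 -> H != set0 ->
    antichain F -> antichain G -> antichain H -> cross_union s F G H ->
    (forall A, A \in F -> #|A| < s) ->
  #|F| + #|G| + #|H| <= 2 + 'C(#|X|, s) /\
  (#|F| + #|G| + #|H| = 2 + 'C(#|X|, s) -> extremal s F G H).
Proof.
move=> s0 hn n4 F0 G0 H0 aF aG aH cross ltF.
have cG B : B \in G -> #|B| <= s.
  move=> BG; have [A AF] := set0Pn _ F0; have [C CH] := set0Pn _ H0.
  apply: leq_trans (cross A B C AF BG CH); apply: subset_leq_card.
  by rewrite setUAC subsetUr.
have cH C : C \in H -> #|C| <= s.
  move=> CH; have [A AF] := set0Pn _ F0; have [B BG] := set0Pn _ G0.
  by apply: leq_trans (cross A B C AF BG CH); apply/subset_leq_card/subsetUr.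
set T1 := fun i => seg X 0 i; set T2 := fun j => seg X (#|X| - j) #|X|.
set T3 := fun k => seg X s.-1 (s.-1 + k).
have ch1 : chain s T1 := chain_init hn.
have ch2 : chain s T2 := chain_final hn.
have ch3 : chain s T3 := chain_middle hn.
set M := 2 + 'C(#|X|, s).
pose w sigma := weight s T1 F sigma + weight s T2 G sigma + weight s T3 H sigma.
have bound sigma : w sigma <= M /\
    (w sigma = M -> exists i j k, [/\ optimal #|X| s i j k,
      sigma @: T1 i \in F, sigma @: T2 j \in G & sigma @: T3 k \in H]).
  have [i [le_i wi [A AF iA] hi]] := weightP sigma ch1 aF F0.
  have [j [le_j wj [B BG jB] hj]] := weightP sigma ch2 aG G0.
  have [k [le_k wk [C CH kC] hk]] := weightP sigma ch3 aH H0.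
  have lt_i : i < s.
    apply: leq_trans (ltF A AF); rewrite ltnS -(ch1.1 i le_i).
    by rewrite -(card_imset _ (@perm_inj _ sigma)) subset_leq_card.
  have ijk : i + j + k <= s.
    apply: (@cover_segs X) => //; apply: leq_trans (cross A B C AF BG CH).
    rewrite -(card_imset _ (@perm_inj _ sigma)) !imsetU subset_leq_card //.
    by rewrite !setUSS.
  have [le opt] := bin_add3 hn n4 ijk; rewrite -/M in le opt.
  have le_w : w sigma <= 'C(#|X|, i) + 'C(#|X|, j) + 'C(#|X|, k).
    by rewrite !leq_add.
  split=> [|wM]; first exact: leq_trans le_w le.
  exists i, j, k.
  have eM : 'C(#|X|, i) + 'C(#|X|, j) + 'C(#|X|, k) = M.
    by apply/eqP; rewrite eqn_leq le -wM le_w.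
  rewrite /w in wM.
  by split; [apply: opt | apply: hi | apply: hj | apply: hk] => //; lia.
have sum_w :
    \sum_(sigma : {perm X}) w sigma = #|{perm X}| * (#|F| + #|G| + #|H|).
  by rewrite !big_split /= !sum_weight ?mulnDr // => A /ltF/ltnW.
have N0 : 0 < #|{perm X}| by apply/card_gt0P; exists 1%g.
have := @leqif_sum _ predT _ w (fun=> M)
  (fun sigma _ => leqif_eq (bound sigma).1).
rewrite sum_w sum_nat_const => -[le eq].
split=> [|card]; first by move: le; rewrite leq_pmul2l.
apply: (@optimal_system_extremal s T1 T2 T3) => //; split=> // sigma.
apply: (bound sigma).2; apply/eqP.
by move: eq; rewrite card eqxx => /esym/forallP/(_ sigma).
Qed.

End ExtremalTriples.

Lemma perm_eq_card (X : finType) (F G H F' G' H' : {set {set X}}) :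
  perm_eq [:: F; G; H] [:: F'; G'; H'] ->
  #|F| + #|G| + #|H| = #|F'| + #|G'| + #|H'|.
Proof.
move=> /(perm_map (fun K : {set {set X}} => #|K|))/perm_sumn /=.
by rewrite !addn0 !addnA.
Qed.

Lemma cross_unionC (X : finType) s (F G H : {set {set X}}) :
  cross_union s F G H -> cross_union s G F H.
Proof. by move=> cross A B C AG BF CH; rewrite (setUC A) cross. Qed.

Lemma cross_unionR (X : finType) s (F G H : {set {set X}}) :
  cross_union s F G H -> cross_union s F H G.
Proof. by move=> cross A B C AF BH CG; rewrite setUAC cross. Qed.

(** If some family has no [s]-set, reorder and apply [bound_extremal_lt];
    otherwise the total is 3, which is less than [2 + n <= 2 + C(n, s)]. *)
Lemma bound_extremal (X : finType) s (F G H : {set {set X}}) :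
    0 < s -> s.*2 <= #|X| -> (#|X|, s) <> (4, 2) ->
    F != set0 -> G != set0 -> H != set0 ->
    antichain F -> antichain G -> antichain H -> cross_union s F G H ->
  #|F| + #|G| + #|H| <= 2 + 'C(#|X|, s) /\
  (#|F| + #|G| + #|H| = 2 + 'C(#|X|, s) -> extremal s F G H).
Proof.
move=> s0 hn n4 F0 G0 H0 aF aG aH cross.
have small (K : {set {set X}}) : (forall A, A \in K -> #|A| < s) \/
    exists2 A : {set X}, A \in K & s <= #|A|.
  have [/existsP[A /andP[AK sA]] | none] :=
    boolP [exists A, (A \in K) && (s <= #|A|)].
    by right; exists A.
  left=> A AK; rewrite ltnNge; apply: contra none => sA.
  by apply/existsP; exists A; rewrite AK.
have [ltF | [A AF sA]] := small F; first exact: bound_extremal_lt.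
have [ltG | [B BG sB]] := small G.
  have [le eq] := bound_extremal_lt s0 hn n4 G0 F0 H0 aG aF aH
    (cross_unionC cross) ltG.
  by rewrite (addnC #|F|); split=> // /eq/extremalC.
have [ltH | [C CH sC]] := small H.
  have [le eq] := bound_extremal_lt s0 hn n4 H0 F0 G0 aH aF aG
    (cross_unionC (cross_unionR cross)) ltH.
  by rewrite addnAC (addnC #|F|); split=> // /eq/extremalC/extremalR.
(* Every family has a member of size s: all three equal A :|: B :|: C, and each
   family is a singleton. *)
have U := cross A B C AF BG CH.
have single (K : {set {set X}}) (D : {set X}) :
    antichain K -> D \in K -> s <= #|D| ->
    (forall E, E \in K -> #|D :|: E| <= s) -> #|K| = 1.
  move=> aK DK sD DE; apply/eqP/cards1P; exists D; apply/setP=> E; rewrite inE.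
  apply/idP/eqP => [EK | -> //]; apply: contraTeq (EK) => ne; apply/negP=> _.
  have /negP[] := aK _ _ EK DK ne.
  have /eqP -> : D == D :|: E by rewrite eqEcard subsetUl (leq_trans (DE E EK)).
  exact: subsetUr.
have full (D E : {set X}) : D \subset E -> s <= #|D| -> #|E| <= s -> D = E.
  by move=> DE sD sE; apply/eqP; rewrite eqEcard DE (leq_trans sE).
have eA : A = A :|: B :|: C by apply: full => //; rewrite -setUA subsetUl.
have eB : B = A :|: B :|: C by apply: full => //; rewrite setUAC subsetUr.
have eC : C = A :|: B :|: C by apply: full => //; rewrite subsetUr.
have [eBA eCA] : B = A /\ C = A by split; [rewrite eB | rewrite eC].
have -> : #|F| = 1.
  apply: (single _ A) => // E EF; have := cross E B C EF BG CH.
  by rewrite eBA eCA -setUA setUid setUC.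
have -> : #|G| = 1.
  apply: (single _ B) => // E EG; have := cross A E C AF EG CH.
  by rewrite eCA setUAC setUid eBA.
have -> : #|H| = 1.
  apply: (single _ C) => // E EH; have := cross A B E AF BG EH.
  by rewrite eBA setUid eCA.
by have := bin_le s0 hn; rewrite bin1; lia.
Qed.

Theorem theorem1p5 (n s : nat) (X : finType) (F G H : {set {set X}})
    (hs : 0 < 2 * s) (hn : 2 * s <= n) (hns : (n, s) <> (4, 2))
    (hX : #|X| = n)
    (F0 : F != set0) (G0 : G != set0) (H0 : H != set0)
    (aF : antichain F) (aG : antichain G) (aH : antichain H)
    (hFGH : cross_union s F G H) :
  [/\ #|F| + #|G| + #|H| <= 2 + 'C(n, s),
      (n, s) <> (6, 3) ->
        (#|F| + #|G| + #|H| = 2 + 'C(n, s) <->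
         perm_eq [:: F; G; H] [:: ksubsets X s; [set set0]; [set set0]])
    & (n, s) = (6, 3) ->
        (#|F| + #|G| + #|H| = 2 + 'C(n, s) <->
         perm_eq [:: F; G; H] [:: ksubsets X 3; [set set0]; [set set0]] \/
         perm_eq [:: F; G; H] [:: ksubsets X 2; ksubsets X 1; [set set0]])].
Proof.
have s0 : 0 < s by lia.
have hn2 : s.*2 <= #|X| by lia.
rewrite -hX in hns *.
have [le eq] := bound_extremal s0 hn2 hns F0 G0 H0 aF aG aH hFGH.
have attained : perm_eq [:: F; G; H] [:: ksubsets X s; [set set0]; [set set0]] ->
    #|F| + #|G| + #|H| = 2 + 'C(#|X|, s).
  by move=> /perm_eq_card ->; rewrite card_ksubsets !cards1 -addnA addnC.
split=> // [ne | [n6 s3]]; split=> //.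
- by case/eq => // -[n6 s3]; case: ne; rewrite n6 s3.
- by case/eq => [|[_ _]] ?; [left; rewrite -s3 | right].
- case=> [|/perm_eq_card ->]; first by rewrite -s3.
  by rewrite !card_ksubsets cards1 n6 s3.
Qed.
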